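(* The space $\mathfrak S_{-1}=\bigcup_{p\in\mathbb Z}\mathcal H_{-p}$, endowed with the inductive limit topology and with the product $(f,g)\mapsto fg$, is a strong algebra.
   Context: Let $i_1,i_2,\dots$ be Grassmann generators: $i_ni_m+i_mi_n=0$ for all $n,m$. Let $\mathfrak I$ be the set of finite tuples $\alpha=(a_1,\dots,a_t)$, $t\ge1$, of positive integers with $a_1<\cdots<a_t$; $i_\alpha=i_{a_1}\cdots i_{a_t}$; $\mathfrak I_0=\mathfrak I\cup\{0\}$ with $i_0=1$. For $\alpha,\beta\in\mathfrak I_0$ having no common entry, $\alpha\vee\beta=\gamma\in\mathfrak I_0$ is the increasing tuple formed by the entries of $\alpha$ and $\beta$ (with $0\vee\alpha=\alpha\vee0=\alpha$), and $i_\alpha i_\beta=(-1)^{\sigma(\alpha,\beta)}i_\gamma$, where $\sigma(\alpha,\beta)$ is the number of transpositions needed to reorder; if $\alpha,\beta$ have a common entry, $i_\alpha i_\beta=0$ and no $\gamma$ satisfies $\alpha\vee\beta=\gamma$. Let $(c_\alpha)_{\alpha\in\mathfrak I_0}$ be positive real numbers with $c_\alpha\ge 1$, $c_\alpha c_\beta\le c_\gamma$ whenever $\alpha\vee\beta=\gamma$, and $\sum_{\alpha\in\mathfrak I_0}c_\alpha^{-2d}<\infty$ for every positive integer $d$. For $p\in\mathbb Z$, $\mathcal H_{-p}$ is the space of formal series $f=\sum_{\alpha\in\mathfrak I_0}f_\alpha i_\alpha$ ($f_\alpha\in\mathbb C$) with $\Vert f\Vert_{\mathcal H_{-p}}=\left(\sum_{\alpha}|f_\alpha|^2c_\alpha^{-2p}\right)^{1/2}<\infty$;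 thus $\mathcal H_{-q}\subseteq\mathcal H_{-p}$ if $p\ge q$. The product is $fg=\sum_{\gamma}\Big(\sum_{\alpha\vee\beta=\gamma}(-1)^{\sigma(\alpha,\beta)}f_\alpha g_\beta\Big)i_\gamma$. A strong algebra is an associative algebra $\mathcal A$ which is the locally convex inductive limit of a family of Banach spaces $(X_s)_{s\in A}$ directed under inclusion, such that for every $s\in A$ there is $h(s)\in A$ with the following property: for every $r\ge h(s)$ there is a constant $A_{r,s}>0$ such that for all $x\in X_s$, $y\in X_r$ one has $\Vert xy\Vert_{r}\le A_{r,s}\Vert x\Vert_s\Vert y\Vert_r$ and $\Vert yx\Vert_{r}\le A_{r,s}\Vert x\Vert_s\Vert y\Vert_r$. *)

(* Defs.v *)
From HB Require Import structures.
From mathcomp Require Import all_boot all_order all_algebra.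
From mathcomp Require Import all_classical all_reals all_analysis.
From mathcomp Require Import complex.
From mathcomp Require Import ring lra.

Set Implicit Arguments.
Unset Strict Implicit.
Unset Printing Implicit Defensive.

Import Order.TTheory GRing.Theory Num.Theory.
Import ComplexField numFieldNormedType.Exports.
Local Open Scope classical_set_scope.
Local Open Scope ring_scope.

(* T, a family of subsets of the vector space E, is the family of open sets of
   a locally convex vector space topology on E; F is E with that topology. *)
Definition lc_topology (K : numFieldType) (E : lmodType K)
    (T : set (set E)) : Prop :=
  exists (F : tvsType K) (u : {linear E -> F}),
    bijective u /\ T = [set u @^-1` U | U in [set U : set F | open U]].

(* The topology of E is the finest locally convex one for which all the maps
   incl s are continuous. *)
Definition lc_inductive_limit (K : numFieldType) (E : preTopologicalLmodType K)
    (A : Type) (X : A -> normedModType K) (incl : forall s, {linear X s -> E})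
    : Prop :=
  [/\ lc_topology [set U : set E | open U],
      (forall s, continuous (incl s)) &
      forall T : set (set E), lc_topology T ->
        (forall s U, T U -> open (incl s @^-1` U)) ->
        forall U, T U -> open U].

Definition banach (K : numFieldType) (V : normedModType K) : Prop :=
  forall F : set_system V, ProperFilter F -> cauchy F -> cvg F.

(* No unit is required.  The subspaces X_s of E are given as normed spaces with
   injective linear maps incl s into E, and the index set carries the order of
   inclusion. *)
Record strong_algebra (K : numFieldType) (E : preTopologicalLmodType K)
    (mul : E -> E -> E) (d : Order.disp_t) (A : preorderType d)
    (X : A -> normedModType K) (incl : forall s, {linear X s -> E}) : Prop := {
  sa_mulA : associative mul;
  sa_mul_linearl : forall (a : K) x y z,
    mul (a *: x + y) z = a *: mul x z + mul y z;
  sa_mul_linearr : forall (a : K) x y z,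
    mul z (a *: x + y) = a *: mul z x + mul z y;
  sa_banach : forall s, banach (X s);
  sa_incl_inj : forall s, injective (incl s);
  sa_index_order : forall s r : A,
    (s <= r)%O <-> range (incl s) `<=` range (incl r);
  sa_incl_continuous : forall s r : A, (s <= r)%O ->
    exists2 i : X s -> X r, continuous i & forall x, incl r (i x) = incl s x;
  sa_index_inhabited : inhabited A;
  sa_directed : forall s t : A, exists r, (s <= r)%O /\ (t <= r)%O;
  sa_union : \bigcup_s range (incl s) = [set: E];
  sa_topology : lc_inductive_limit incl;
  sa_strong : forall s : A, exists h : A, forall r : A, (h <= r)%O ->
    exists2 a : K, 0 < a & forall (x : X s) (y : X r),
      (exists2 z : X r, incl r z = mul (incl s x) (incl r y) &
         `|z| <= a * `|x| * `|y|) /\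
      (exists2 z : X r, incl r z = mul (incl r y) (incl s x) &
         `|z| <= a * `|x| * `|y|)
}.

(* The standard construction of the locally convex inductive limit topology:
   the absolutely convex W whose traces on all the X_s are neighbourhoods of 0
   form a basis of neighbourhoods of 0. *)
Definition ilim_open (K : numFieldType) (E : lmodType K) (A : Type)
    (X : A -> normedModType K) (incl : forall s, X s -> E) : set (set E) :=
  [set U | forall x, U x -> exists W : set E,
    [/\ convex_set W,
        (forall (k : K) w, `|k| <= 1 -> W w -> W (k *: w)),
        (forall s, nbhs (0 : X s) (incl s @^-1` W)) &
        forall w, W w -> U (x + w)]].

Section ilim_open_theory.
Context (K : numFieldType) (E : lmodType K) (A : Type).
Context (X : A -> normedModType K) (incl : forall s, X s -> E).

Lemma ilim_openT : ilim_open incl [set: E].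
Proof.
move=> x _; exists [set: E]; split=> // s.
by rewrite preimage_setT; exact: filterT.
Qed.

Lemma ilim_openI : setI_closed (ilim_open incl).
Proof.
move=> U V oU oV x [/oU[W1 [c1 b1 n1 s1]] /oV[W2 [c2 b2 n2 s2]]].
exists (W1 `&` W2); split.
- move=> a b l /set_mem[a1 a2] /set_mem[e1 e2]; apply/mem_set.
  by split; apply/set_mem; [apply: c1|apply: c2]; exact/mem_set.
- by move=> k w k1 [w1 w2]; split; [exact: b1|exact: b2].
- by move=> s; rewrite preimage_setI; exact: filterI.
- by move=> w [w1 w2]; split; [exact: s1|exact: s2].
Qed.

Lemma ilim_open_bigU (I : Type) (f : I -> set E) :
  (forall i, ilim_open incl (f i)) -> ilim_open incl (\bigcup_i f i).
Proof.
move=> of_ x [i _ /of_[W [cW bW nW sW]]]; exists W; split=> // w /sW fw.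
by exists i.
Qed.

End ilim_open_theory.

(* Increasing tuples of positive integers; the empty tuple is the index 0. *)
Record gidx := Gidx { gval :> seq nat; _ : path ltn 0%N gval }.
HB.instance Definition _ := [isSub for gval].
HB.instance Definition _ := [Countable of gidx by <:].

(* vee al be ga: al and be have no common entry and al \/ be = ga (ga has no
   repeated entry, hence disjointness). *)
Definition vee (al be ga : gidx) : Prop := perm_eq (al ++ be) ga.

(* Moving the entries of be to their places transposes each pair of an entry a
   of al and an entry b < a of be once. *)
Definition gsigma (al be : gidx) : nat :=
  (\sum_(a <- gval al) count (fun b => b < a)%N (gval be))%N.

Record weights (R : realType) := Weights {
  wt :> gidx -> R;
  wt_ge1 : forall al, 1 <= wt al;
  wt_vee : forall al be ga, vee al be ga -> wt al * wt be <= wt ga;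
  wt_summable : forall d : nat, (0 < d)%N ->
    (\esum_(al in [set: gidx]) (wt al ^ (- (2 * d%:Z)))%:E < +oo)%E
}.

(* The series \sum_al f_al i_al is the function al |-> f_al. *)
Notation gseries R := (gidx -> R[i]).

Definition gmul (R : realType) (f g : gseries R) : gseries R := fun ga =>
  \sum_(ab \in [set ab : gidx * gidx | vee ab.1 ab.2 ga])
    ((-1) ^+ gsigma ab.1 ab.2 * f ab.1 * g ab.2).

Section spaces.
Context (R : realType) (c : weights R).
Implicit Types (p q : int) (f g : gseries R) (al : gidx).

Definition sqnorm p f : \bar R :=
  \esum_(al in [set: gidx]) (Normc.normc (f al) ^+ 2 * c al ^ (- (2 * p)))%:E.

(* Beware of the sign: Hset p is H_{-p}, with the weights c_al^(-2p). *)
Definition Hset p : set (gseries R) := [set f | (sqnorm p f < +oo)%E].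

Lemma wt_gt0 al : 0 < c al.
Proof. exact: lt_le_trans (wt_ge1 c al). Qed.

Lemma term_ge0 p f al : 0 <= Normc.normc (f al) ^+ 2 * c al ^ (- (2 * p)).
Proof. by rewrite mulr_ge0 ?sqr_ge0// exprz_ge0// ltW// wt_gt0. Qed.

Lemma sqnorm_ge0 p f : (0 <= sqnorm p f)%E.
Proof. by apply: esum_ge0 => al _; rewrite lee_fin term_ge0. Qed.

Lemma sqnorm0 p : sqnorm p 0 = 0%E.
Proof.
by apply: esum1 => al _; rewrite Normc.normc0 expr0n/= mul0r.
Qed.

Lemma sqnorm_ge p f al :
  ((Normc.normc (f al) ^+ 2 * c al ^ (- (2 * p)))%:E <= sqnorm p f)%E.
Proof.
apply: esum_ge; exists [set al]; first by split=> //; exact: finite_set1.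
by rewrite fsbig_set1.
Qed.

Lemma sqnorm_eq0 p f : sqnorm p f = 0%E -> f = 0.
Proof.
move=> f0; apply/funext => al; apply: Normc.eq0_normc.
have := sqnorm_ge p f al; rewrite f0 lee_fin.
rewrite pmulr_lle0 ?exprz_gt0 ?wt_gt0// => n0.
have /eqP : Normc.normc (f al) ^+ 2 = 0.
  by apply/eqP; rewrite eq_le n0 sqr_ge0.
by rewrite sqrf_eq0 => /eqP.
Qed.

Lemma esumZ_le (k : R) (a : gidx -> \bar R) :
  0 <= k -> (forall i, 0 <= a i)%E ->
  (\esum_(i in [set: gidx]) (k%:E * a i)
     <= k%:E * \esum_(i in [set: gidx]) a i)%E.
Proof.
move=> k0 a0; apply: ge_ereal_sup => _ [B fB <-].
rewrite -ge0_mule_fsumr//; apply: lee_wpmul2l; first by rewrite lee_fin.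
by apply: esum_ge; exists B.
Qed.

Lemma sqnormZ_le p (k : R[i]) f :
  (sqnorm p (k *: f) <= (Normc.normc k ^+ 2)%:E * sqnorm p f)%E.
Proof.
have t0 al : (0 <= (Normc.normc (f al) ^+ 2 * c al ^ (- (2 * p)))%:E)%E.
  by rewrite lee_fin term_ge0.
apply: le_trans (esumZ_le (sqr_ge0 (Normc.normc k)) t0).
apply: le_esum => al _; rewrite -EFinM lee_fin.
by rewrite [(k *: f) al]/(k * f al) Normc.normcM exprMn -mulrA.
Qed.

Lemma sqnormZ p (k : R[i]) f :
  sqnorm p (k *: f) = ((Normc.normc k ^+ 2)%:E * sqnorm p f)%E.
Proof.
have [->|k0] := eqVneq k 0.
  by rewrite scale0r sqnorm0 Normc.normc0 expr0n/= mul0e.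
apply/eqP; rewrite eq_le sqnormZ_le/=.
have nk0 : Normc.normc k != 0.
  by apply: contra_neq k0; exact: Normc.eq0_normc.
have := sqnormZ_le p k^-1 (k *: f).
rewrite scalerA mulVf// scale1r Normc.normcV exprVn => H.
have := lee_wpmul2l _ H; move/(_ (Normc.normc k ^+ 2)%:E).
rewrite lee_fin sqr_ge0 => /(_ isT) /le_trans; apply.
by rewrite muleA -EFinM mulfV ?expf_eq0// mul1e.
Qed.

Lemma sqnormD_le p f g (s : R) : 0 < s ->
  (sqnorm p (f + g)%R <=
    (1 + s)%:E * sqnorm p f + (1 + s^-1)%:E * sqnorm p g)%E.
Proof.
move=> s0; have s0' : 0 < s^-1 by rewrite invr_gt0.
have h (k : R) u : 0 <= k ->
    (\esum_(i in [set: gidx])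
       (k%:E * (Normc.normc (u i) ^+ 2 * c i ^ (- (2 * p)))%:E)
     <= k%:E * sqnorm p u)%E.
  by move=> k0; apply: esumZ_le => // i; rewrite lee_fin term_ge0.
have k1 : 0 <= 1 + s by rewrite addr_ge0// ltW.
have k2 : 0 <= 1 + s^-1 by rewrite addr_ge0// ltW.
apply: le_trans (leeD (h _ f k1) (h _ g k2)).
rewrite -esumD; last 2 first.
- by move=> i _; rewrite -EFinM lee_fin mulr_ge0// term_ge0.
- by move=> i _; rewrite -EFinM lee_fin mulr_ge0// term_ge0.
apply: le_esum => al _; rewrite -!EFinM -EFinD lee_fin !mulrA -mulrDl.
apply: ler_wpM2r; first by rewrite exprz_ge0// ltW// wt_gt0.
set x := Normc.normc (f al); set y := Normc.normc (g al).
have x0 : 0 <= x by rewrite /x; case: (f al) => ? ?; exact: sqrtr_ge0.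
have y0 : 0 <= y by rewrite /y; case: (g al) => ? ?; exact: sqrtr_ge0.
have xy : Normc.normc ((f + g) al) <= x + y by exact: le_normcD.
have n0 : 0 <= Normc.normc ((f + g) al).
  by case: ((f + g) al) => ? ?; exact: sqrtr_ge0.
apply: (@le_trans _ _ ((x + y) ^+ 2)).
  by rewrite lerXn2r// nnegrE addr_ge0.
rewrite -subr_ge0 [leRHS](_ : _ = s^-1 * (s * x - y) ^+ 2).
  by rewrite mulr_ge0 ?sqr_ge0// ltW.
by field; rewrite gt_eqF.
Qed.

Lemma Hset_submod p : submod_closed [in Hset p].
Proof.
split; first by rewrite inE /Hset/= sqnorm0.
move=> k f g /[!inE] fp gp; rewrite /Hset/=.
apply: le_lt_trans (sqnormD_le p (k *: f) g ltr01) _.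
by rewrite lte_add_pinfty// ?sqnormZ ?lte_mul_pinfty// ?lee_fin ?sqr_ge0//;
   rewrite ?addr_ge0 ?invr_ge0.
Qed.

Lemma Hset_mono p q : q <= p -> Hset q `<=` Hset p.
Proof.
move=> qp f; apply: le_lt_trans; apply: le_esum => al _; rewrite lee_fin.
apply: ler_wpM2l; first exact: sqr_ge0.
by apply: ler_weXz2l; rewrite ?wt_ge1// lerN2 ler_pM2l.
Qed.

Definition Sset : set (gseries R) := \bigcup_p Hset p.

Lemma Sset_submod : submod_closed [in Sset].
Proof.
split.
  rewrite inE; exists 0 => //.
  by have [/[!inE]] := Hset_submod 0.
move=> k f g /[!inE] -[p _ fp] [q _ gq]; exists (Num.max p q) => //.
have [_ /(_ k f g)] := Hset_submod (Num.max p q); rewrite !inE; apply.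
- by apply: Hset_mono fp; rewrite le_max lexx.
- by apply: Hset_mono gq; rewrite le_max lexx orbT.
Qed.

Definition Hpred p : {pred gseries R} := [in Hset p].
Definition Spred : {pred gseries R} := [in Sset].

HB.instance Definition _ p :=
  GRing.isSubmodClosed.Build _ _ (Hpred p) (Hset_submod p).
HB.instance Definition _ :=
  GRing.isSubmodClosed.Build _ _ Spred Sset_submod.

Record Hspace p := HSpace { hval :> gseries R; hvalP : hval \in Hpred p }.
HB.instance Definition _ p := [isSub for @hval p].
HB.instance Definition _ p := [Choice of Hspace p by <:].
HB.instance Definition _ p := [SubChoice_isSubLmodule of Hspace p by <:].

Record Sminus1 := SMinus1 { Sval :> gseries R; SvalP : Sval \in Spred }.
HB.instance Definition _ := [isSub for Sval].
HB.instance Definition _ := [Choice of Sminus1 by <:].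
HB.instance Definition _ := [SubChoice_isSubLmodule of Sminus1 by <:].

Definition hnorm p (f : Hspace p) : R := Num.sqrt (fine (sqnorm p f)).

Lemma hnorm_ge0 p (f : Hspace p) : 0 <= hnorm f.
Proof. exact: sqrtr_ge0. Qed.

Lemma Hspace_finite p (f : Hspace p) : (sqnorm p f < +oo)%E.
Proof. by have := hvalP f; rewrite inE. Qed.

Lemma sqr_hnorm p (f : Hspace p) : (hnorm f ^+ 2)%:E = sqnorm p f.
Proof.
rewrite /hnorm sqr_sqrtr ?fine_ge0 ?sqnorm_ge0// fineK//.
by rewrite ge0_fin_numE ?sqnorm_ge0 ?Hspace_finite.
Qed.

Lemma hnorm0_eq0 p (f : Hspace p) : hnorm f = 0 -> f = 0.
Proof.
move=> f0; apply: val_inj; apply: (@sqnorm_eq0 p).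
by rewrite -[LHS]sqr_hnorm f0 expr0n.
Qed.

Lemma hnormZ p (k : R[i]) (f : Hspace p) :
  hnorm (k *: f) = Normc.normc k * hnorm f.
Proof.
have k0 : 0 <= Normc.normc k by case: (k) => ? ?; exact: sqrtr_ge0.
apply/eqP; rewrite -(@eqrXn2 _ 2) ?mulr_ge0 ?hnorm_ge0//; apply/eqP.
by apply/EFin_inj; rewrite sqr_hnorm exprMn EFinM sqr_hnorm -sqnormZ.
Qed.

Lemma ler_hnormD p (f g : Hspace p) : hnorm (f + g) <= hnorm f + hnorm g.
Proof.
have [/hnorm0_eq0->|f0] := eqVneq (hnorm f) 0.
  by rewrite add0r lerDr hnorm_ge0.
have [/hnorm0_eq0->|g0] := eqVneq (hnorm g) 0.
  by rewrite addr0 lerDl hnorm_ge0.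
have fp : 0 < hnorm f by rewrite lt_neqAle eq_sym f0 hnorm_ge0.
have gp : 0 < hnorm g by rewrite lt_neqAle eq_sym g0 hnorm_ge0.
rewrite -(@ler_pXn2r _ 2) ?nnegrE ?addr_ge0 ?hnorm_ge0//.
rewrite -lee_fin sqr_hnorm.
apply: le_trans (sqnormD_le p f g (divr_gt0 gp fp)) _.
rewrite -!sqr_hnorm -!EFinM -EFinD lee_fin.
rewrite le_eqVlt; apply/orP; left; apply/eqP.
by field; rewrite f0 g0.
Qed.

(* A normedModType over R[i] takes its norms in R[i]. *)
Definition hnormC p (f : Hspace p) : R[i] := (hnorm f)%:C%C.

Lemma ler_hnormCD p (f g : Hspace p) : hnormC (f + g) <= hnormC f + hnormC g.
Proof. by rewrite /hnormC -rmorphD lecR ler_hnormD. Qed.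

Lemma hnormCZ p (k : R[i]) (f : Hspace p) : hnormC (k *: f) = `|k| * hnormC f.
Proof. by rewrite /hnormC hnormZ rmorphM. Qed.

Lemma hnormC0_eq0 p (f : Hspace p) : hnormC f = 0 -> f = 0.
Proof. by case=> /hnorm0_eq0. Qed.

HB.instance Definition _ p := Lmodule_isNormed.Build R[i] (Hspace p)
  (@ler_hnormCD p) (@hnormCZ p) (@hnormC0_eq0 p).

Lemma Hspace_sub p (f : Hspace p) : (f : gseries R) \in Spred.
Proof. by rewrite inE; exists p => //; exact: Hspace_finite. Qed.

Definition hincl p (f : Hspace p) : Sminus1 := SMinus1 (Hspace_sub f).

Lemma hincl_is_linear p : linear (@hincl p).
Proof. by move=> k f g; exact: val_inj. Qed.

HB.instance Definition _ p :=
  GRing.isLinear.Build R[i] (Hspace p) Sminus1 *:%R (@hincl p)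
    (@hincl_is_linear p).

HB.instance Definition _ := isOpenTopological.Build Sminus1
  (ilim_openT hincl) (@ilim_openI _ _ _ _ hincl)
  (@ilim_open_bigU _ _ _ _ hincl).

End spaces.

(* Main.v *)
(* Vage's inequality: for r >= 0 and r > p, the weights satisfy
   c_ga^(-r) <= c_al^(-r) c_be^(-r) whenever al \/ be = ga, and for fixed ga the
   factor be is determined by al.  Cauchy-Schwarz against c_al^(-(r-p)) then
   gives ||fg||_r^2 <= (\sum_al c_al^(-2(r-p))) ||f||_p^2 ||g||_r^2, and
   likewise for gf; so h(p) = max(p+1, 0) works.  The restriction r >= 0 is
   needed since c_al c_be <= c_ga bounds c_ga^(-r) from above only for such r.
   Associativity is an exact identity of signs, because sigma is additive in
   each argument along \/.  That the order of the indices is inclusion uses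
   that there are infinitely many indices: for q < p the series
   \sum_al c_al^q i_al lies in H_{-p} but not in H_{-q}. *)

Require Import Defs.
From HB Require Import structures.
From mathcomp Require Import all_boot all_order all_algebra.
From mathcomp Require Import all_classical all_reals all_analysis.
From mathcomp Require Import complex.
From mathcomp Require Import ring lra.

Set Implicit Arguments.
Unset Strict Implicit.
Unset Printing Implicit Defensive.

Import Order.TTheory GRing.Theory Num.Theory.
Import ComplexField numFieldNormedType.Exports.
Local Open Scope classical_set_scope.
Local Open Scope ring_scope.

(* The factory [PreTopologicalLmod_isTvs] only yields the uniform structure, so
   the other structures of a tvs are packed by hand. *)
Lemma lc_topology_open (K : numFieldType) (E : preTopologicalLmodType K) :
  continuous (fun x : E * E => x.1 + x.2) ->
  continuous (fun z : K^o * E => z.1 *: z.2) ->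
  (exists2 B : set_system E, (forall b, b \in B -> convex_set b) & basis B) ->
  lc_topology [set U : set E | open U].
Proof.
move=> Dcont Zcont lcE.
pose F1 : TopologicalNmodule.type := HB.pack (PreTopologicalLmodule.sort E)
  (PreTopologicalNmodule_isTopologicalNmodule.Build E Dcont).
pose F2 : topologicalLmodType K := HB.pack (PreTopologicalLmodule.sort E) F1
  (TopologicalNmodule_isTopologicalLmodule.Build K F1 Zcont).
pose F3 : PreUniformLmodule.type K := HB.pack (PreTopologicalLmodule.sort E) F2
  (PreTopologicalLmod_isTvs.Build K F2 Dcont Zcont lcE).
pose F : tvsType K := HB.pack (PreTopologicalLmodule.sort E) F2 F3
  (Uniform_isTvs.Build K F3 lcE).
exists F, (idfun : {linear E -> E}); split; first by exists idfun.
apply/seteqP; split => [U oU|_ [V oV <-]]; last exact: oV.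
by exists U.
Qed.

(** Trades the bundled interval type [{i01 K}] for a plain scalar with two inequalities. *)
Lemma convex_setE (K : numFieldType) (E : lmodType K) (W : set E) :
  convex_set W <-> forall (t : K) x y, 0 <= t <= 1 ->
    W x -> W y -> W (t *: x + (1 - t) *: y).
Proof.
split=> [cW t x y /andP[t0 t1] Wx Wy|cW x y t /set_mem Wx /set_mem Wy].
  by have /set_mem := cW x y (Itv01 t0 t1) (mem_set Wx) (mem_set Wy).
by apply/mem_set/cW => //; rewrite ge0 le1.
Qed.

(** * The locally convex inductive limit topology *)

Section inductive_limit.
Context (K : numFieldType) (E : preTopologicalLmodType K) (A : Type).
Context (X : A -> normedModType K) (incl : forall s, {linear X s -> E}).
Hypothesis openE : forall U : set E, open U = ilim_open incl U.
Hypothesis unionE : \bigcup_s range (incl s) = [set: E].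

(** The absolutely convex basic neighbourhoods of 0 in [ilim_open]; they need not be open
    themselves. *)
Let zero_nbhd (W : set E) : Prop := [/\ convex_set W,
  (forall (k : K) w, `|k| <= 1 -> W w -> W (k *: w)) &
  (forall s, nbhs (0 : X s) (incl s @^-1` W))].

Let zero_nbhdI W1 W2 :
  zero_nbhd W1 -> zero_nbhd W2 -> zero_nbhd (W1 `&` W2).
Proof.
move=> [c1 b1 n1] [c2 b2 n2]; split.
- move=> a b l /set_mem[a1 a2] /set_mem[e1 e2]; apply/mem_set.
  by split; apply/set_mem; [apply: c1|apply: c2]; exact/mem_set.
- by move=> k w k1 [w1 w2]; split; [exact: b1|exact: b2].
- by move=> s; rewrite preimage_setI; exact: filterI.
Qed.

(** Taking the preimage under multiplication by [k], instead of an image, covers [k = 0] as well and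
    needs only continuity of scaling in each [X s]. *)
Let zero_nbhdZ W (k : K) : zero_nbhd W -> zero_nbhd [set w | W (k *: w)].
Proof.
move=> [/convex_setE cW bW nW]; split.
- apply/convex_setE => t x y t01 /= Wx Wy.
  by rewrite scalerDr !scalerA ![k * _]mulrC -!scalerA; exact: cW.
- by move=> l w l1 /= Ww; rewrite scalerA mulrC -scalerA; exact: bW.
- move=> s; rewrite [X in nbhs _ X](_ : _ =
      ( *:%R k) @^-1` (incl s @^-1` W)); last first.
    by apply/funext => x; rewrite /preimage /= linearZ.
  by apply: (@scaler_continuous K (X s) k 0); rewrite /= scaler0; exact: nW.
Qed.

Let zero_nbhd0 (a0 : A) W : zero_nbhd W -> W 0.
Proof.
by case=> _ _ /(_ a0) /nbhs_singleton /=; rewrite linear0.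
Qed.

(** The vector [x] lies in some [X s], where the trace of [W] is a neighbourhood of 0 and scalar
    multiples of a fixed vector tend to 0. *)
Let zero_nbhd_absorb W x : zero_nbhd W ->
  exists2 d : K, 0 < d & forall k, `|k| < d -> W (k *: x).
Proof.
move=> [_ _ nW].
have : [set: E] x by []. rewrite -unionE => -[s _ [y _ <-]].
have /scalel_continuous : nbhs ((0 : K) *: y) (incl s @^-1` W).
  by rewrite scale0r.
move=> [d d0 dW]; exists d => // k kd; have := dW k.
by rewrite /ball_/= sub0r normrN linearZ; exact.
Qed.

(** The sum is the midpoint of [2 *: x] and [2 *: y]. *)
Let zero_nbhd_half W x y : zero_nbhd W ->
  W (2 *: x) -> W (2 *: y) -> W (x + y).
Proof.
move=> [/convex_setE cW _ _] Wx Wy.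
have h : 0 <= (2^-1 : K) <= 1 by rewrite invr_ge0 ler0n invf_le1// ler1n.
have := cW _ _ _ h Wx Wy; have -> : 1 - 2^-1 = 2^-1 :> K by field.
by rewrite !scalerA mulVf ?pnatr_eq0// !scale1r.
Qed.

Let nbhs_ilim (x : E) U :
  nbhs x U <-> exists2 W, zero_nbhd W & forall w, W w -> U (x + w).
Proof.
split.
  rewrite nbhsE => -[B [+ Bx] BU]; rewrite openE => /(_ x Bx)[W [? ? ? sW]].
  by exists W => // w /sW /BU.
move=> [W nW WU].
have [s0 _ _] : (\bigcup_s range (incl s)) x by rewrite unionE.
rewrite nbhsE.
(* The candidate for the interior of [U]. It is open by halving: if y + V lies in [U], then each
   point of y + V/2 still has V/2 as room inside [U]. *)
exists [set y | exists2 W, zero_nbhd W & forall w, W w -> U (y + w)].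
  split; last by exists W.
  rewrite openE => y [V nV VU].
  have [c b n] := zero_nbhdZ 2 nV.
  exists [set w | V (2 *: w)]; split=> // w /= Vw.
  exists [set w | V (2 *: w)] => // v /= Vv.
  by rewrite -addrA; apply/VU/(zero_nbhd_half nV).
by move=> y [V nV /(_ 0)]; rewrite addr0; apply; exact: zero_nbhd0 nV.
Qed.

Let add_continuous_ilim : continuous (fun x : E * E => x.1 + x.2).
Proof.
move=> [x y] U /= /nbhs_ilim[W nW WU].
have n2W := zero_nbhdZ 2 nW.
exists ([set x + w | w in [set w | W (2 *: w)]],
        [set y + w | w in [set w | W (2 *: w)]]).
  by split; apply/nbhs_ilim; exists [set w | W (2 *: w)] => // w Ww; exists w.
case=> y1 y2 /= [[v Wv <-] [w Ww <-]].
by rewrite addrACA; apply/WU/(zero_nbhd_half nW).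
Qed.

Let scale_continuous_ilim : continuous (fun z : K^o * E => z.1 *: z.2).
Proof.
move=> [k x] U /= /nbhs_ilim[W nW WU].
have n2W := zero_nbhdZ 2 nW.
have [d d0 dW] := zero_nbhd_absorb x n2W.
have nkW := zero_nbhdZ (`|k| + 1) n2W.
have k1 : 0 < `|k| + 1 by rewrite ltr_wpDl.
(* The bound by [d] makes [W] absorb (l - k) x; the bound by 1 gives |l| <= |k| + 1. The order of
   [K] is partial, so comparing [d] with 1 uses that [d] is real. *)
have [e [e0 ed e1]] : exists e : K, [/\ 0 < e, e <= d & e <= 1].
  have [d1|/ltW d1] := real_leP (gtr0_real d0) (real1 K); first by exists d.
  by exists 1.
exists (ball (k : K^o) e,
        [set x + w | w in [set w | W (2 *: ((`|k| + 1) *: w))]]).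
  split; first exact: nbhsx_ballx.
  by apply/nbhs_ilim; exists [set w | W (2 *: ((`|k| + 1) *: w))] => // w Ww;
    exists w.
case=> l y /= [kl [w Ww yE]]; rewrite -yE.
have lk : `|l - k| < e by rewrite distrC; exact: kl.
(* With y = x + w, each of the two error terms has its double in [W]: the first by absorption, the
   second because [W] is balanced and |l / (|k| + 1)| <= 1. *)
rewrite [l *: _](_ : _ = k *: x + ((l - k) *: x + l *: w)); last first.
  by rewrite scalerDr addrA -scalerDl [k + _]addrC subrK.
apply/WU/(zero_nbhd_half nW).
  exact/dW/(lt_le_trans lk).
have -> : 2 *: (l *: w) = (l / (`|k| + 1)) *: (2 *: ((`|k| + 1) *: w)).
  by rewrite !scalerA; congr (_ *: _); field; rewrite gt_eqF.
case: nW => _ bW _; apply: bW Ww.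
rewrite normrM normfV (gtr0_norm k1) ler_pdivrMr// mul1r.
rewrite -[l](subrK k) (le_trans (ler_normD _ _))// addrC lerD2l ltW//.
exact: lt_le_trans lk _.
Qed.

Let basis_ilim :
  exists2 B : set_system E, (forall b, b \in B -> convex_set b) & basis B.
Proof.
exists [set U | open U /\ convex_set U].
  by move=> U /set_mem[].
split=> [U []//|x U /nbhs_ilim[W nW WU]].
have [s0 _ _] : (\bigcup_s range (incl s)) x by rewrite unionE.
(* The interior of x + W, an open set that inherits convexity: a common translation by w of two
   points is also the translation by w of their convex combinations. *)
exists [set y | nbhs y [set x + w | w in W]]; last first.
  by move=> y /nbhs_singleton[w /WU + <-].
split; last by apply/nbhs_ilim; exists W => // w Ww; exists w.
split; first exact: open_interior.
apply/convex_setE => t y z t01 /nbhs_ilim[V nV Vy] /nbhs_ilim[V' nV' Vz].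
apply/nbhs_ilim; exists (V `&` V'); first exact: zero_nbhdI.
move=> w [Vw V'w].
have [a Wa ya] := Vy _ Vw; have [b Wb zb] := Vz _ V'w.
exists (t *: a + (1 - t) *: b).
  by case: nW => /convex_setE cW _ _; exact: cW.
have -> : w = t *: w + (1 - t) *: w by rewrite -scalerDl addrC subrK scale1r.
rewrite addrACA -!scalerDr -ya -zb !scalerDr addrACA -scalerDl.
by rewrite [t + _]addrC subrK scale1r.
Qed.

Lemma lc_inductive_limit_ilim : lc_inductive_limit incl.
Proof.
split; first exact: lc_topology_open.
- move=> s x U /nbhs_ilim[W [_ _ /(_ s) nW] WU].
  have /= := nbhsT x nW; apply: filterS => _ [y Wy <-] /=.
  by rewrite linearD; exact: WU.
(* Finest topology: around each point of a set open in a competing topology, an absolutely convex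
   [W] is extracted from the local convexity of [F] and the continuity of the maps into it. *)
move=> _ [F [u [bu ->]]] oT _ [U oU <-].
rewrite openE => x /= Uux.
have [B cB [oB bB]] := @locally_convex K F.
have nU0 : nbhs (0 : F) [set v | U (u x + v)].
  have := @add_continuous F (u x, 0) U.
  rewrite /= addr0 => /(_ (open_nbhs_nbhs (conj oU Uux)))[[P Q]] /= [nP nQ] PQ.
  by apply: filterS nQ => v Qv; apply: (PQ (u x, v)); split => //;
    exact: nbhs_singleton nP.
have [C [BC C0] CU] := bB _ _ nU0.
have nC0 : nbhs (0 : F) C by apply: open_nbhs_nbhs; split => //; exact: oB.
have [D [oD D0 DC]] : exists D : set F, [/\ open D, D 0 &
    forall v (k : K), D v -> `|k| <= 1 -> C (k *: v)].
  have := @scale_continuous K F (0, 0) C.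
  rewrite /= scaler0 => /(_ nC0)[[P Q]] /= [[d /= d0 dP] nQ] PQ.
  have d2 : d / 2 != 0 by rewrite mulf_neq0 ?invr_eq0 ?pnatr_eq0 ?gt_eqF.
  (* For |k| <= 1 the scalar k d/2 has modulus below [d], so it stays in [P], and its product with a
     point of [Q] lies in [C]. *)
  exists ( *:%R (d / 2) @` Q)°; split; first exact: open_interior.
    exact: nbhs0Z.
  move=> v k /interior_subset[q Qq <-] k1; rewrite scalerA.
  apply: (PQ (k * (d / 2), q)); split => //; apply: dP.
  rewrite /ball_/= sub0r normrN normrM (@gtr0_norm _ (d / 2)) ?divr_gt0//.
  rewrite (le_lt_trans (ler_piMl _ k1)) ?divr_ge0 ?(ltW d0)//.
  by rewrite ltr_pdivrMr// ltr_pMr// ltr1n.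
(* The balanced core of C, which is a neighbourhood of 0 since it contains D. *)
exists [set w | forall k : K, `|k| <= 1 -> C (k *: u w)]; split.
- apply/convex_setE => t y z t01 /= Cy Cz k k1.
  rewrite linearD !linearZ scalerDr !scalerA ![k * _]mulrC -!scalerA.
  have /convex_setE := cB C (mem_set BC); apply => //; [exact: Cy|exact: Cz].
- move=> k w k1 /= Cw l l1; rewrite linearZ scalerA; apply: Cw.
  by rewrite normrM mulr_ile1.
- move=> s.
  have := oT s _ (ex_intro2 _ _ D oD erefl) => oD'.
  apply: (@filterS _ _ _ (incl s @^-1` (u @^-1` D))).
    by move=> v /= Dv k k1; exact: DC.
  by apply: open_nbhs_nbhs; split => //=; rewrite !linear0.
- move=> w /(_ 1); rewrite normr1 lexx scale1r => /(_ isT) /CU /=.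
  by rewrite linearD.
Qed.

End inductive_limit.

(** * Completeness of the spaces of series *)

Lemma normc_sqrE (R : rcfType) (z : R[i]) :
  Normc.normc z ^+ 2 = complex.Re z ^+ 2 + complex.Im z ^+ 2.
Proof. by case: z => a b; rewrite sqr_sqrtr// addr_ge0 ?sqr_ge0. Qed.

Lemma normc_ge0 (R : rcfType) (z : R[i]) : 0 <= Normc.normc z.
Proof. by case: z => a b; exact: sqrtr_ge0. Qed.

Lemma normr_Re_le (R : rcfType) (z : R[i]) : `|complex.Re z| <= Normc.normc z.
Proof.
rewrite -ler_sqr ?nnegrE ?normc_ge0// normc_sqrE real_normK ?num_real//.
by rewrite lerDl sqr_ge0.
Qed.

Lemma normr_Im_le (R : rcfType) (z : R[i]) : `|complex.Im z| <= Normc.normc z.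
Proof.
rewrite -ler_sqr ?nnegrE ?normc_ge0// normc_sqrE real_normK ?num_real//.
by rewrite lerDr sqr_ge0.
Qed.

Lemma cvg_sum_seq (R : numFieldType) (V : normedModType R) (T I : Type)
    (F : set_system T) (FF : Filter F) (s : seq I) (f : I -> T -> V)
    (l : I -> V) :
  (forall i, f i x @[x --> F] --> l i) ->
  \sum_(i <- s) f i x @[x --> F] --> \sum_(i <- s) l i.
Proof.
move=> fl; elim: s => [|i s IH].
  by rewrite big_nil; under eq_cvg do rewrite big_nil; exact: cvg_cst.
by rewrite big_cons; under eq_cvg do rewrite big_cons; exact: cvgD.
Qed.

Lemma cvg_sqr_normcB (R : realType) (T : Type) (F : set_system T)
    (FF : Filter F) (f : T -> R[i]) (w z : R[i]) :
  complex.Re (f x) @[x --> F] --> complex.Re z ->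
  complex.Im (f x) @[x --> F] --> complex.Im z ->
  Normc.normc (w - f x) ^+ 2 @[x --> F] --> Normc.normc (w - z) ^+ 2.
Proof.
move=> fRe fIm; rewrite normc_sqrE !raddfB.
under eq_cvg do rewrite normc_sqrE !raddfB !expr2.
by apply: cvgD; apply: cvgM; apply: cvgB => //; exact: cvg_cst.
Qed.

Lemma esum_le_fin (R : realType) (T : choiceType) (a : T -> R) (M : R) :
  (forall s : seq T, uniq s -> \sum_(i <- s) a i <= M) ->
  (\esum_(i in [set: T]) (a i)%:E <= M%:E)%E.
Proof.
move=> aM; apply: ge_ereal_sup => _ [B [fB _] <-].
by rewrite fsbig_finite// sumEFin lee_fin; exact: aM.
Qed.

Section complete.
Context (R : realType) (c : weights R) (p : int).

Lemma sum_le_sqnorm (f : gseries R) (s : seq gidx) : uniq s ->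
  ((\sum_(al <- s) Normc.normc (f al) ^+ 2 * c al ^ (- (2 * p)))%:E
    <= sqnorm c p f)%E.
Proof.
move=> us; apply: esum_ge; exists [set` s].
  by split => //; exact: finite_seq.
by rewrite -sumEFin (fsbig_seq _ _ us).
Qed.

Lemma wt_exprN2 al : c al ^ (- (2 * p)) = ((c al ^ p) ^+ 2)^-1.
Proof. by rewrite [_ ^+ 2]exprnP exprz_exp invr_expz mulrC. Qed.

(** A single term is at most the whole sum. Hence coefficients depend continuously on the series,
    and Cauchy filters converge coefficientwise. *)
Lemma normc_le_hnorm (f : Hspace c p) al :
  Normc.normc (f al) <= c al ^ p * hnorm f.
Proof.
rewrite -ler_sqr ?nnegrE ?normc_ge0//; last first.
  by rewrite mulr_ge0 ?hnorm_ge0// exprz_ge0// ltW ?wt_gt0.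
rewrite exprMn -ler_pdivrMl ?exprn_gt0 ?exprz_gt0 ?wt_gt0//.
rewrite mulrC -lee_fin sqr_hnorm; apply: le_trans (sqnorm_ge c p f al).
by rewrite lee_fin wt_exprN2.
Qed.

Lemma ball_Hspace (f g : Hspace c p) (e : R) :
  ball f e%:C%C g <-> hnorm (f - g) < e.
Proof. by rewrite -ball_normE /= -ltcR. Qed.

Lemma banach_Hspace : banach (Hspace c p).
Proof.
move=> F PF /cauchy_ballP Fc.
have {}Fc (e : R) : 0 < e -> exists2 A, F A &
    forall f g, A f -> A g -> hnorm (f - g) < e.
  rewrite -ltcR => /Fc[[A B]] /= [FA FB] AB.
  exists (A `&` B); first exact: filterI.
  by move=> f g [Af _] [_ Bg]; apply/ball_Hspace/(AB (f, g)).
have coord (q : R[i] -> R) al : (forall z w, q (z - w) = q z - q w) ->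
    (forall z, `|q z| <= Normc.normc z) -> cvg (q (hval f al) @[f --> F]).
  move=> qB q_le; apply/cauchy_cvgP/cauchy_ballP => e e0.
  have c0 : 0 < c al ^ p by rewrite exprz_gt0 ?wt_gt0.
  have [A FA Ae] := Fc _ (divr_gt0 e0 c0).
  pose QA := [set q (hval f al) | f in A].
  have FQA : F [set f | QA (q (hval f al))].
    by apply: filterS FA => f Af; exists f.
  exists (QA, QA) => //= -[_ _] /= [[f Af <-] [g Ag <-]].
  rewrite /ball/= -qB (le_lt_trans (q_le _))//.
  apply: le_lt_trans (normc_le_hnorm (f - g) al) _.
  by rewrite mulrC -ltr_pdivlMr//; exact: Ae.
have cvRe al :=
  coord (@complex.Re R) al (fun z w => raddfB _ z w) (@normr_Re_le R).
have cvIm al :=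
  coord (@complex.Im R) al (fun z w => raddfB _ z w) (@normr_Im_le R).
pose g : gseries R := fun al => (lim (complex.Re (hval f al) @[f --> F]) +i*
  lim (complex.Im (hval f al) @[f --> F]))%C.
(* Pass to the limit in h in the bounds of the finite partial sums of f - h. *)
have fg (e : R) : 0 < e -> exists2 A, F A &
    forall f, A f -> (sqnorm c p (hval f - g)%R <= (e ^+ 2)%:E)%E.
  move=> e0; have [A FA Ae] := Fc _ e0; exists A => // f Af.
  apply: esum_le_fin => s us.
  have : \sum_(al <- s) Normc.normc (hval f al - hval h al) ^+ 2 *
        c al ^ (- (2 * p)) @[h --> F] -->
      \sum_(al <- s) Normc.normc (hval f al - g al) ^+ 2 * c al ^ (- (2 * p)).
    apply: cvg_sum_seq => al; apply: cvgMr_tmp.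
    by apply: cvg_sqr_normcB; [exact: cvRe|exact: cvIm].
  move=> /cvgr_to_le; apply; apply: filterS FA => h Ah.
  rewrite -lee_fin; apply: le_trans (sum_le_sqnorm (f - h) us) _.
  by rewrite -sqr_hnorm lee_fin ler_sqr ?nnegrE ?hnorm_ge0 ?(ltW e0)// ltW ?Ae.
(* The limit differs from a member [f] of the space by a series of finite norm. *)
have gp : g \in Hpred c p.
  have [A /filter_ex[f Af] Ag] := fg 1 ltr01.
  have -> : g = hval f - (hval f - g) by rewrite subKr.
  by rewrite rpredB ?hvalP// inE /Hset/= (le_lt_trans (Ag _ Af))// ltry.
apply: (cvgP (HSpace gp)); apply/cvg_ballP => e e0.
have [e1 e0'] : e = (complex.Re e)%:C%C /\ 0 < complex.Re e.
  have er := gtr0_real e0; move: (e0); rewrite -{1}(RRe_real er) ltcR => ?.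
  by rewrite RRe_real.
(* Limits only preserve weak inequalities; half the radius restores the strict one required by
   balls. *)
have [A FA Ag] := fg _ (divr_gt0 e0' (ltr0n R 2)).
apply: filterS FA => f /Ag sf; rewrite e1; apply/ball_sym/ball_Hspace.
apply: (@le_lt_trans _ _ (complex.Re e / 2)).
  rewrite -ler_sqr ?nnegrE ?hnorm_ge0// ?divr_ge0 ?(ltW e0')//.
  by rewrite -lee_fin sqr_hnorm.
by rewrite ltr_pdivrMr// ltr_pMr// ltr1n.
Qed.

End complete.

(** * The product of formal series *)

Section indices.
Implicit Types al be ga de : gidx.

Lemma gidx_path al : path ltn 0%N (gval al).
Proof. exact: (valP al). Qed.

Lemma gidx_uniq al : uniq (gval al).
Proof.
exact: (sorted_uniq ltn_trans ltnn (path_sorted (gidx_path al))).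
Qed.

Lemma gidx_inj al be : gval al =i gval be -> al = be.
Proof.
move=> ab; apply: val_inj; apply: (irr_sorted_eq ltn_trans ltnn) => //.
  exact: path_sorted (gidx_path al).
exact: path_sorted (gidx_path be).
Qed.

Lemma veeC al be ga : vee al be ga -> vee be al ga.
Proof. by rewrite /vee perm_catC. Qed.

Lemma mem_vee al be ga x : vee al be ga ->
  (x \in gval ga) = (x \in gval al) || (x \in gval be).
Proof. by move=> /perm_mem <-; rewrite mem_cat. Qed.

Lemma vee_uniq al be ga : vee al be ga -> uniq (gval al ++ gval be).
Proof. by move=> /perm_uniq ->; exact: gidx_uniq. Qed.

Lemma vee_funr al be ga ga' : vee al be ga -> vee al be ga' -> ga = ga'.
Proof.
by move=> v v'; apply: gidx_inj => x; rewrite (mem_vee x v) (mem_vee x v').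
Qed.

Lemma vee_inj al be be' ga : vee al be ga -> vee al be' ga -> be = be'.
Proof.
move=> v v'; apply: gidx_inj => x.
have : perm_eq (gval al ++ gval be) (gval al ++ gval be').
  by rewrite (permPl v) perm_sym.
by rewrite perm_cat2l => /perm_mem.
Qed.

Lemma vee_ex al be : uniq (gval al ++ gval be) -> exists ga, vee al be ga.
Proof.
move=> u; have p : path ltn 0%N (sort leq (gval al ++ gval be)).
  rewrite (path_sortedE ltn_trans) ltn_sorted_uniq_leq sort_uniq u.
  rewrite (sort_sorted leq_total) all_sort all_cat.
  have h := path_sortedE ltn_trans 0%N.
  by move: (gidx_path al) (gidx_path be); rewrite !h => /andP[-> _] /andP[-> _].
by exists (Gidx p); rewrite /vee perm_sym perm_sort.
Qed.

(** Both sides say that the concatenation of the three tuples is a permutation of [de]. The missing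
    intermediate index exists because part of a duplicate-free list is duplicate-free and can be
    sorted. *)
Lemma veeA al be ga de :
  (exists2 e, vee al be e & vee e ga de) <->
  (exists2 e, vee al e de & vee be ga e).
Proof.
split=> [[e v w]|[e v w]].
  have p : perm_eq (gval al ++ (gval be ++ gval ga)) (gval de).
    by rewrite catA -(permPr w) perm_cat2r.
  have [|e' v'] := @vee_ex be ga.
    by have := gidx_uniq de; rewrite -(perm_uniq p) cat_uniq => /and3P[].
  by exists e' => //; rewrite /vee -(permPr p) perm_cat2l perm_sym.
have p : perm_eq ((gval al ++ gval be) ++ gval ga) (gval de).
  by rewrite -catA -(permPr v) perm_cat2l.
have [|e' v'] := @vee_ex al be.
  by have := gidx_uniq de; rewrite -(perm_uniq p) cat_uniq => /and3P[].
by exists e' => //; rewrite /vee -(permPr p) perm_cat2r perm_sym.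
Qed.

Lemma gsigma_veel al be ga de : vee al be ga ->
  gsigma ga de = (gsigma al de + gsigma be de)%N.
Proof. by move=> v; rewrite /gsigma -(perm_big _ v) big_cat. Qed.

Lemma gsigma_veer al be ga de : vee al be ga ->
  gsigma de ga = (gsigma de al + gsigma de be)%N.
Proof.
move=> v; rewrite /gsigma -big_split/=; apply: eq_bigr => a _.
by move/permP: v => <-; rewrite count_cat.
Qed.

(** Both components are subtuples of [ga], and a subtuple is cut out by a boolean mask of the length
    of [ga]. *)
Lemma finite_vee ga : finite_set [set ab : gidx * gidx | vee ab.1 ab.2 ga].
Proof.
pose S := [set al | {subset gval al <= gval ga}].
have fS : finite_set S.
  pose T := (size (gval ga)).-tuple bool.
  pose f (m : T) : gidx := insubd ga (mask m (gval ga)).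
  apply: (@sub_finite_set _ _ (f @` [set: T])); last first.
    by apply: finite_image; exact: finite_finset.
  move=> al /= alga.
  exists (map_tuple (fun x => x \in gval al) (in_tuple (gval ga))) => //.
  apply: gidx_inj => x; rewrite /f val_insubd/= -filter_mask.
  rewrite ifT ?mem_filter; last first.
    by apply: path_filter (gidx_path ga) => //; exact: ltn_trans.
  by case: (boolP (x \in gval al)) => // /alga.
apply: (@sub_finite_set _ _ (S `*` S)); last exact: finite_setX.
by move=> [al be] /= v; split=> x xa; rewrite (mem_vee x v) xa ?orbT.
Qed.

(** A list, so that finite sums can be reindexed by permutation and concatenation. *)
Definition splits ga : seq (gidx * gidx) :=
  finmap.enum_fset (fset_set [set ab : gidx * gidx | vee ab.1 ab.2 ga]).

Lemma mem_splits ga ab : (ab \in splits ga) <-> vee ab.1 ab.2 ga.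
Proof.
rewrite /splits.
have := in_fset_set (finite_vee ga) => /(_ ab) ->.
by rewrite inE.
Qed.

Lemma splits_uniq ga : uniq (splits ga).
Proof. exact: finmap.fset_uniq. Qed.

End indices.

(** * Bilinearity and associativity of the product *)

Section product.
Context (R : realType).
Implicit Types f g h : gseries R.

Lemma gmulE f g ga : gmul f g ga =
  \sum_(ab <- splits ga) (-1) ^+ gsigma ab.1 ab.2 * f ab.1 * g ab.2.
Proof. by rewrite /gmul fsbig_finite//; exact: finite_vee. Qed.

Lemma eq_splits ga (F G : gidx * gidx -> R[i]) :
  (forall al be, vee al be ga -> F (al, be) = G (al, be)) ->
  \sum_(ab <- splits ga) F ab = \sum_(ab <- splits ga) G ab.
Proof. by move=> FG; apply: eq_big_seq => -[al be] /mem_splits /FG. Qed.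

Lemma gmulDZl (a : R[i]) f g h : gmul (a *: f + g) h = a *: gmul f h + gmul g h.
Proof.
apply/funext => ga; rewrite -[RHS]/(a * gmul f h ga + gmul g h ga) !gmulE.
rewrite mulr_sumr -big_split/=; apply: eq_bigr => ab _.
rewrite -[(a *: f + g) ab.1]/(a * f ab.1 + g ab.1).
by rewrite mulrDr mulrDl mulrCA !mulrA.
Qed.

Lemma gmulDZr (a : R[i]) f g h : gmul h (a *: f + g) = a *: gmul h f + gmul h g.
Proof.
apply/funext => ga; rewrite -[RHS]/(a * gmul h f ga + gmul h g ga) !gmulE.
rewrite mulr_sumr -big_split/=; apply: eq_bigr => ab _.
rewrite -[(a *: f + g) ab.2]/(a * f ab.2 + g ab.2).
by rewrite mulrDr mulrCA.
Qed.

Lemma gmulA : associative (@gmul R).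
Proof.
move=> f g h; apply/funext => de; rewrite !gmulE.
(* Both bracketings expand to a sum of the same term over triples, its sign exponent being the sum
   of sigma over the three ordered pairs. [L1] and [L2] list the triples as each bracketing produces
   them. *)
pose T (t : gidx * (gidx * gidx)) :=
  (-1) ^+ (gsigma t.1 t.2.1 + gsigma t.1 t.2.2 + gsigma t.2.1 t.2.2) *
    f t.1 * g t.2.1 * h t.2.2.
pose L1 := [seq (x.1, y) | x <- splits de, y <- splits x.2].
pose L2 := [seq (y.1, (y.2, x.2)) | x <- splits de, y <- splits x.1].
transitivity (\sum_(t <- L1) T t).
  rewrite /L1 big_allpairs_dep; apply: eq_splits => al e v.
  rewrite gmulE mulr_sumr; apply: eq_splits => be ga w.
  rewrite /T/= (gsigma_veer al w) [in RHS]exprD -!mulrA; congr (_ * _).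
  by rewrite mulrCA.
transitivity (\sum_(t <- L2) T t); last first.
  rewrite /L2 big_allpairs_dep; apply: eq_splits => e ga v.
  rewrite gmulE mulr_sumr mulr_suml; apply: eq_splits => al be w.
  by rewrite /T/= (gsigma_veel ga w) -addnA addnC exprD -!mulrA.
(* Neither list has repetitions: the forgotten intermediate index is determined by the two indices
   it joins. They have the same members by [veeA]. *)
apply: perm_big; apply: uniq_perm.
- apply: allpairs_uniq_dep => [|x _|]; [exact: splits_uniq..|].
  move=> u u' /allpairsPdep[[a e] [[b d] [/mem_splits/= v /mem_splits/= w uE]]].
  move=> /allpairsPdep[[a' e'] [[b' d']]].
  move=> [/mem_splits/= v' /mem_splits/= w' uE'].
  rewrite uE uE' /= => -[aE bE dE]; subst a' b' d'.
  by have ee := vee_funr w w'; subst e'.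
- apply: allpairs_uniq_dep => [|x _|]; [exact: splits_uniq..|].
  move=> u u' /allpairsPdep[[e d] [[a b] [/mem_splits/= v /mem_splits/= w uE]]].
  move=> /allpairsPdep[[e' d'] [[a' b']]].
  move=> [/mem_splits/= v' /mem_splits/= w' uE'].
  rewrite uE uE' /= => -[aE bE dE]; subst a' b' d'.
  by have ee := vee_funr w w'; subst e'.
- move=> [al [be ga]]; apply/idP/idP.
    move=> /allpairsPdep[[a e] [[b d] [/mem_splits/= v /mem_splits/= w]]].
    case=> -> -> ->.
    have /veeA[e' v' w'] : exists2 e, vee a e de & vee b d e by exists e.
    by apply/allpairsPdep; exists (e', d), (a, b); split=> //; exact/mem_splits.
  move=> /allpairsPdep[[e d] [[a b] [/mem_splits/= v /mem_splits/= w]]].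
  case=> -> -> ->.
  have /veeA[e' v' w'] : exists2 e, vee a b e & vee e d de by exists e.
  by apply/allpairsPdep; exists (a, e'), (b, d); split=> //; exact/mem_splits.
Qed.

End product.

(** * Vage's inequality *)

Lemma cauchy_schwarz_seq (R : realDomainType) (I : Type) (s : seq I)
    (u v : I -> R) :
  (\sum_(i <- s) u i * v i) ^+ 2 <=
    (\sum_(i <- s) u i ^+ 2) * \sum_(i <- s) v i ^+ 2.
Proof.
elim: s => [|i s IH]; first by rewrite !big_nil expr0n mul0r.
rewrite !big_cons; set A := \sum_(j <- s) u j ^+ 2 in IH *.
set B := \sum_(j <- s) v j ^+ 2 in IH *.
set C := \sum_(j <- s) u j * v j in IH *.
have A0 : 0 <= A by apply: sumr_ge0 => j _; exact: sqr_ge0.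
have B0 : 0 <= B by apply: sumr_ge0 => j _; exact: sqr_ge0.
move: (u i) (v i) => x y.
(* The cross term of the induction step. After squaring, the induction hypothesis bounds C^2 by A B,
   and what remains is the square of x^2 B - A y^2. *)
suff : 2 * (x * y * C) <= x ^+ 2 * B + A * y ^+ 2.
  move: IH; rewrite -subr_ge0 => IH; rewrite -subr_ge0 => H; rewrite -subr_ge0.
  have -> : (x ^+ 2 + A) * (y ^+ 2 + B) - (x * y + C) ^+ 2 =
    (A * B - C ^+ 2) + (x ^+ 2 * B + A * y ^+ 2 - 2 * (x * y * C)) by ring.
  exact: addr_ge0.
apply: le_trans (ler_norm _) _.
have D0 : 0 <= x ^+ 2 * B + A * y ^+ 2 by rewrite addr_ge0// mulr_ge0// sqr_ge0.
rewrite -ler_sqr ?nnegrE// real_normK ?num_real//.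
have := ler_wpM2l (sqr_ge0 (x * y)) IH => H.
apply: (@le_trans _ _ (4 * ((x * y) ^+ 2 * (A * B)))).
  have -> : (2 * (x * y * C)) ^+ 2 = 4 * ((x * y) ^+ 2 * C ^+ 2) by ring.
  by rewrite ler_pM2l.
rewrite -subr_ge0.
have -> : (x ^+ 2 * B + A * y ^+ 2) ^+ 2 - 4 * ((x * y) ^+ 2 * (A * B)) =
  (x ^+ 2 * B - A * y ^+ 2) ^+ 2 by ring.
exact: sqr_ge0.
Qed.

Section vage.
Context (R : realType) (c : weights R).

Lemma esum_wt_lty (k : int) : 0 < k ->
  (\esum_(al in [set: gidx]) (c al ^ (- (2 * k)))%:E < +oo)%E.
Proof. by case: k => // d d0; exact: wt_summable. Qed.

(** The first component determines the second once [ga] is fixed, so no index occurs twice on the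
    left. *)
Lemma sum_splits1_le (k : gidx -> R) ga : (forall al, 0 <= k al) ->
  ((\sum_(ab <- splits ga) k ab.1)%:E <= \esum_(al in [set: gidx]) (k al)%:E)%E.
Proof.
move=> k0; rewrite -(big_map fst xpredT k).
have us : uniq (map fst (splits ga)).
  rewrite map_inj_in_uniq ?splits_uniq// => -[a b] [a' b'].
  move=> /mem_splits/= v /mem_splits/= w ?; subst a'.
  by rewrite (vee_inj v w).
apply: esum_ge; exists [set` map fst (splits ga)].
  by split => //; exact: finite_seq.
by rewrite -sumEFin (fsbig_seq _ _ us).
Qed.

(** A pair determines its join, so different [ga] contribute disjoint sets of pairs and the left
    side is a partial sum over all pairs. *)
Lemma sum_splits_le (F G : gidx -> R) (s : seq gidx) :
  (forall al, 0 <= F al) -> (forall al, 0 <= G al) -> uniq s ->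
  ((\sum_(ga <- s) \sum_(ab <- splits ga) F ab.1 * G ab.2)%:E <=
   \esum_(al in [set: gidx]) \esum_(be in [set: gidx]) (F al * G be)%:E)%E.
Proof.
move=> F0 G0 us; rewrite esum_esum; last first.
  by move=> i j _ _; rewrite lee_fin mulr_ge0.
rewrite -(@big_allpairs_dep _ _ _ _ _ _ (fun _ ab => ab) s (fun ga => splits ga)
   (fun ab => F ab.1 * G ab.2)).
set L := [seq ab | _ <- s, ab <- _].
have uL : uniq L.
  apply: allpairs_uniq_dep => // [x _|]; first exact: splits_uniq.
  move=> u u' /allpairsPdep[e [[a b] [_ /mem_splits/= v uE]]].
  move=> /allpairsPdep[e' [[a' b'] [_ /mem_splits/= v' uE']]].
  rewrite uE uE' /= => -[aE bE]; subst a' b'.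
  by have ee := vee_funr v v'; subst e'.
apply: esum_ge; exists [set` L]; first by split => //; exact: finite_seq.
by rewrite -sumEFin (fsbig_seq _ _ uL).
Qed.

(** The series [h] enters only through a bound on its coefficients that ignores signs and the order
    of the factors; this serves both fg and gf. [F] and [G] bound squared norms. *)
Lemma vage (p r : int) (M F G : R) (f g h : gseries R) :
  0 <= r ->
  (\esum_(al in [set: gidx]) (c al ^ (- (2 * (r - p))))%:E <= M%:E)%E ->
  (sqnorm c p f <= F%:E)%E -> (sqnorm c r g <= G%:E)%E ->
  (forall ga, Normc.normc (h ga) <=
    \sum_(ab <- splits ga) Normc.normc (f ab.1) * Normc.normc (g ab.2)) ->
  (sqnorm c r h <= (M * (F * G))%:E)%E.
Proof.
move=> r0 cM fF gG hfg.
have M0 : 0 <= M.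
  rewrite -lee_fin; apply: le_trans cM; apply: esum_ge0 => al _.
  by rewrite lee_fin exprz_ge0// ltW// wt_gt0.
have F0 : 0 <= F by rewrite -lee_fin (le_trans _ fF)// sqnorm_ge0.
have G0 : 0 <= G by rewrite -lee_fin (le_trans _ gG)// sqnorm_ge0.
pose Ft al := Normc.normc (f al) ^+ 2 * c al ^ (- (2 * p)).
pose Gt al := Normc.normc (g al) ^+ 2 * c al ^ (- (2 * r)).
have Ft0 al : 0 <= Ft al by exact: term_ge0.
have Gt0 al : 0 <= Gt al by exact: term_ge0.
have FtE al : (0 <= (Ft al)%:E)%E by rewrite lee_fin.
have GtE al : (0 <= (Gt al)%:E)%E by rewrite lee_fin.
have term ga : Normc.normc (h ga) ^+ 2 * c ga ^ (- (2 * r)) <=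
    M * \sum_(ab <- splits ga) Ft ab.1 * Gt ab.2.
  (* The Cauchy-Schwarz factors: u v equals |f_a| |g_b| (c_a c_b)^(-r), the squares of [u] sum to at
     most [M], and the square of [v] is the product of the terms of the two squared norms. *)
  pose u (ab : gidx * gidx) := c ab.1 ^ (- (r - p)).
  pose v (ab : gidx * gidx) := (Normc.normc (f ab.1) * c ab.1 ^ (- p)) *
    (Normc.normc (g ab.2) * c ab.2 ^ (- r)).
  have cV al k : 0 <= c al ^ k by rewrite exprz_ge0// ltW// wt_gt0.
  have c2 al (k : int) : c al ^ (- (2 * k)) = (c al ^ (- k)) ^+ 2.
    by rewrite [_ ^+ 2]exprnP exprz_exp mulrC mulNr.
  have -> : \sum_(ab <- splits ga) Ft ab.1 * Gt ab.2 =
      \sum_(ab <- splits ga) v ab ^+ 2.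
    by apply: eq_bigr => ab _; rewrite /Ft /Gt /v !c2 !exprMn.
  apply: (@le_trans _ _ ((\sum_(ab <- splits ga) u ab * v ab) ^+ 2)).
    rewrite c2 -exprMn ler_sqr ?nnegrE; last 2 first.
    - by rewrite mulr_ge0// normc_ge0.
    - by apply: sumr_ge0 => ab _; rewrite /u /v !mulr_ge0// normc_ge0.
    apply: le_trans (ler_wpM2r (cV _ _) (hfg ga)) _.
    rewrite mulr_suml !big_seq; apply: ler_sum => -[a b] /mem_splits/= w.
    have -> : u (a, b) * v (a, b) = Normc.normc (f a) * Normc.normc (g b) *
        ((c a * c b) ^ (- r)).
      have -> : (c a * c b) ^ (- r) =
          c a ^ (- (r - p)) * c a ^ (- p) * c b ^ (- r).
        by rewrite exprzMl ?unitfE ?gt_eqF ?wt_gt0// -expfzDr ?gt_eqF ?wt_gt0//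
          opprB addrAC subrr add0r.
      by rewrite /u /v/=; ring.
    apply: ler_wpM2l; first by rewrite mulr_ge0 ?normc_ge0.
    rewrite -!invr_expz lef_pV2 ?posrE ?exprz_gt0 ?mulr_gt0 ?wt_gt0//.
    case: (r) r0 => // n _.
    by rewrite -!exprnP lerXn2r ?nnegrE ?mulr_ge0 ?(ltW (wt_gt0 _ _)) ?wt_vee.
  apply: le_trans (cauchy_schwarz_seq (splits ga) u v) _.
  apply: ler_wpM2r; first by apply: sumr_ge0 => ab _; exact: sqr_ge0.
  rewrite -lee_fin; apply: le_trans cM.
  apply: le_trans (sum_splits1_le ga (fun al => cV al (- (2 * (r - p))))).
  by rewrite lee_fin le_eqVlt; apply/orP; left; apply/eqP;
     apply: eq_bigr => ab _; rewrite c2.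
apply: esum_le_fin => s us.
apply: (@le_trans _ _
    (M * \sum_(ga <- s) \sum_(ab <- splits ga) Ft ab.1 * Gt ab.2)).
  by rewrite mulr_sumr; apply: ler_sum => ga _; exact: term.
apply: ler_wpM2l => //; rewrite -lee_fin.
apply: le_trans (sum_splits_le Ft0 Gt0 us) _.
(* The double sum factorises: the inner sum over the second index is bounded by [G], the remaining
   one by [F]. *)
apply: (@le_trans _ _ (\esum_(al in [set: gidx]) (G%:E * (Ft al)%:E))%E).
  apply: le_esum => al _; rewrite muleC.
  under eq_esum do rewrite EFinM.
  apply: le_trans (esumZ_le (Ft0 al) GtE) _.
  by apply: lee_wpmul2l; rewrite ?lee_fin.
apply: le_trans (esumZ_le G0 FtE) _.
by rewrite mulrC EFinM; apply: lee_wpmul2l; rewrite ?lee_fin.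
Qed.

End vage.

Lemma nonexpansive_continuous (K : numFieldType) (V W : normedModType K)
    (f : V -> W) : (forall x y, `|f x - f y| <= `|x - y|) -> continuous f.
Proof.
move=> fle x; apply/cvgrPdist_lt => e e0; near=> y.
apply: le_lt_trans (fle _ _) _; near: y.
exact: cvgr_dist_lt.
Unshelve. all: by end_near. Qed.

(** * Stability under the product, order of the indices, and the strong algebra property *)

Section strong.
Context (R : realType) (c : weights R).

Lemma normrE_normc (z : R[i]) : `|z| = (Normc.normc z)%:C%C.
Proof. by []. Qed.

Lemma normc_gmul_le (f g : gseries R) ga : Normc.normc (gmul f g ga) <=
  \sum_(ab <- splits ga) Normc.normc (f ab.1) * Normc.normc (g ab.2).
Proof.
rewrite -lecR -normrE_normc gmulE rmorph_sum/=.
apply: le_trans (ler_norm_sum _ _ _) _; apply: ler_sum => ab _.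
by rewrite !normrM normrX normrN1 expr1n mul1r rmorphM.
Qed.

Lemma sum_splitsC (F : gidx * gidx -> R) ga :
  \sum_(ab <- splits ga) F (ab.2, ab.1) = \sum_(ab <- splits ga) F ab.
Proof.
pose swap (ab : gidx * gidx) := (ab.2, ab.1).
have swapK : involutive swap by case.
rewrite -(big_map swap xpredT F); apply: perm_big; apply: uniq_perm.
- by rewrite map_inj_uniq ?splits_uniq//; exact: inv_inj.
- exact: splits_uniq.
- move=> ab; rewrite -{1}[ab]swapK mem_map; last exact: inv_inj.
  by apply/idP/idP => /mem_splits v; apply/mem_splits; exact: veeC.
Qed.

Lemma normc_gmulC_le (f g : gseries R) ga : Normc.normc (gmul g f ga) <=
  \sum_(ab <- splits ga) Normc.normc (f ab.1) * Normc.normc (g ab.2).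
Proof.
apply: le_trans (normc_gmul_le g f ga) _.
rewrite -(sum_splitsC (fun ab => Normc.normc (f ab.1) * Normc.normc (g ab.2))).
by under [leRHS]eq_bigr do rewrite mulrC.
Qed.

Lemma sqnorm_mono (p q : int) (f : gseries R) : q <= p ->
  (sqnorm c p f <= sqnorm c q f)%E.
Proof.
move=> qp; apply: le_esum => al _; rewrite lee_fin.
apply: ler_wpM2l; first exact: sqr_ge0.
by apply: ler_weXz2l; rewrite ?wt_ge1// lerN2 ler_pM2l.
Qed.

Lemma vage_Hspace (p r : int) : 0 <= r -> p < r ->
  exists2 M : R, 0 < M &
  forall (x : Hspace c p) (y : Hspace c r) (h : gseries R),
    (forall ga, Normc.normc (h ga) <=
      \sum_(ab <- splits ga) Normc.normc (x ab.1) * Normc.normc (y ab.2)) ->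
    exists2 z : Hspace c r, hval z = h & hnorm z <= M * hnorm x * hnorm y.
Proof.
move=> r0 pr; have rp : 0 < r - p by rewrite subr_gt0.
set S := (\esum_(al in [set: gidx]) (c al ^ (- (2 * (r - p))))%:E)%E.
have S0 : (0 <= S)%E.
  by apply: esum_ge0 => al _; rewrite lee_fin exprz_ge0// ltW// wt_gt0.
have SE : (S <= (fine S)%:E)%E.
  by rewrite fineK// ge0_fin_numE//; exact: esum_wt_lty.
have M0 : 0 <= fine S by exact: fine_ge0.
(* The square root already works as a bound; adding 1 makes positivity immediate. *)
exists (Num.sqrt (fine S) + 1); first by rewrite ltr_wpDl ?sqrtr_ge0.
move=> x y h hxy.
have xE : (sqnorm c p x <= (hnorm x ^+ 2)%:E)%E by rewrite sqr_hnorm.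
have yE : (sqnorm c r y <= (hnorm y ^+ 2)%:E)%E by rewrite sqr_hnorm.
have hE := vage r0 SE xE yE hxy.
have hP : h \in Hpred c r by rewrite inE /Hset/= (le_lt_trans hE)// ltry.
exists (HSpace hP) => //.
apply: (@le_trans _ _ (Num.sqrt (fine S) * hnorm x * hnorm y)).
  rewrite -ler_sqr ?nnegrE ?hnorm_ge0 ?mulr_ge0 ?sqrtr_ge0 ?hnorm_ge0//.
  by rewrite -lee_fin sqr_hnorm !exprMn sqr_sqrtr// -mulrA.
by rewrite !ler_wpM2r ?hnorm_ge0// lerDl.
Qed.

Lemma gmul_Spred (f g : Sminus1 c) : gmul (Sval f) (Sval g) \in Spred c.
Proof.
have := SvalP f; rewrite inE => -[p _ fp].
have := SvalP g; rewrite inE => -[q _ gq].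
(* Large enough to contain the second factor and to satisfy both conditions of Vage's inequality
   with the first factor at level [p]. *)
pose r := Num.max (Num.max (p + 1) q) 0.
have r0 : 0 <= r by rewrite le_max lexx orbT.
have pr : p < r by rewrite !lt_max ltrDl ltr01.
have qr : q <= r by rewrite !le_max lexx orbT.
have [M _ H] := vage_Hspace r0 pr.
have fP : Sval f \in Hpred c p by rewrite inE.
have gP : Sval g \in Hpred c r by rewrite inE; exact: Hset_mono gq.
have [z zE _] := H (HSpace fP) (HSpace gP) _ (normc_gmul_le _ _).
by rewrite inE; exists r => //; rewrite -zE; exact: Hspace_finite.
Qed.

Definition Smul (f g : Sminus1 c) : Sminus1 c := SMinus1 (gmul_Spred f g).

Lemma sqr_normc_real (x : R) : Normc.normc x%:C%C ^+ 2 = x ^+ 2.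
Proof. by rewrite normc_sqrE/= expr0n addr0. Qed.

Lemma subset_Hset (p q : int) : Hset c p `<=` Hset c q -> p <= q.
Proof.
move=> pq; rewrite leNgt; apply/negP => qp.
(* At level [p] its squared norm is a convergent sum of negative even powers of the weights; at
   level [q] every term equals 1. *)
pose f : gseries R := fun al => (c al ^ q)%:C%C.
have fE k : sqnorm c k f =
    (\esum_(al in [set: gidx]) (c al ^ (- (2 * (k - q))))%:E)%E.
  apply: eq_esum => al _; rewrite sqr_normc_real; congr _%:E.
  rewrite [_ ^+ 2]exprnP exprz_exp -expfzDr ?gt_eqF ?wt_gt0//; congr (_ ^ _).
  ring.
have /pq : Hset c p f by rewrite /Hset/= fE esum_wt_lty// subr_gt0.
rewrite /Hset/= => fq.
have [n nM] : exists n : nat, fine (sqnorm c q f) < n%:R.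
  exists (Num.truncn (fine (sqnorm c q f))).+1; exact: truncnS_gt.
(* One-entry tuples, shifted by one because entries are positive: [n] distinct ones give a partial
   sum equal to [n], above the supposedly finite squared norm. *)
pose single k : gidx := @Gidx [:: k.+1] isT.
have us : uniq (map single (iota 0 n)).
  by rewrite map_inj_uniq ?iota_uniq// => i j [].
have := sum_le_sqnorm c q f us.
rewrite -[leRHS]fineK ?ge0_fin_numE ?sqnorm_ge0// lee_fin leNgt => /negP; apply.
apply: lt_le_trans nM _; rewrite big_map -[n in leLHS](size_iota 0).
rewrite -sum1_size natr_sum; apply: ler_sum => i _.
rewrite sqr_normc_real [_ ^+ 2]exprnP exprz_exp.
by rewrite -expfzDr ?gt_eqF ?wt_gt0// mulrC subrr expr0z.
Qed.

Lemma Hspace_widen (p q : int) : p <= q -> forall f : Hspace c p,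
  hval f \in Hpred c q.
Proof.
move=> pq f; rewrite inE; apply: (Hset_mono pq); exact: Hspace_finite.
Qed.

Lemma range_hincl (p : int) (f : Sminus1 c) :
  range (@hincl R c p) f <-> Hset c p (Sval f).
Proof.
split=> [[g _ <-]|fp]; first exact: Hspace_finite.
have fP : Sval f \in Hpred c p by rewrite inE.
by exists (HSpace fP) => //; exact: val_inj.
Qed.

Lemma strong_algebra_Sminus1 :
  strong_algebra Smul (fun p : int => @hincl R c p).
Proof.
have unionE : \bigcup_p range (@hincl R c p) = [set: Sminus1 c].
  apply/seteqP; split => // f _.
  have := SvalP f; rewrite inE => -[p _ fp].
  by exists p => //; apply/range_hincl.
split => //.
- by move=> f g h; apply: val_inj; exact: gmulA.
- by move=> a f g h; apply: val_inj; exact: gmulDZl.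
- by move=> a f g h; apply: val_inj; exact: gmulDZr.
- exact: banach_Hspace.
- by move=> p f g [] fg; exact: val_inj.
- move=> p q; split=> [pq f /range_hincl fp|pq].
    by apply/range_hincl; exact: Hset_mono fp.
  apply: subset_Hset => f fp.
  have fS : f \in Spred c by rewrite inE; exists p.
  have /pq/range_hincl : range (@hincl R c p) (SMinus1 fS) by apply/range_hincl.
  exact.
- move=> p q pq.
  exists (fun f => HSpace (Hspace_widen pq f)) => [f|f]; last exact: val_inj.
  (* Since the weights are at least 1, passing to a larger index does not increase the norm. *)
  move: f; apply: nonexpansive_continuous => f g; rewrite lecR.
  rewrite -ler_sqr ?nnegrE ?hnorm_ge0// -lee_fin !sqr_hnorm.
  exact: sqnorm_mono.
- exact: (inhabits 0).
- by move=> p q; exists (Num.max p q); rewrite !le_max !lexx orbT.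
- exact: lc_inductive_limit_ilim.
- move=> p; exists (Num.max (p + 1) 0) => r; rewrite ge_max => /andP[pr r0].
  have {}pr : p < r by rewrite (lt_le_trans _ pr)// ltrDl.
  have [M M0 H] := vage_Hspace r0 pr.
  exists M%:C%C; first by rewrite ltcR.
  move=> x y; split.
    have [z zE zM] := H x y _ (normc_gmul_le _ _).
    exists z; first exact: val_inj.
    by rewrite /Num.norm/= /hnormC -!rmorphM lecR.
  have [z zE zM] := H x y _ (normc_gmulC_le _ _).
  exists z; first exact: val_inj.
  by rewrite /Num.norm/= /hnormC -!rmorphM lecR.
Qed.

End strong.

Theorem corollary4p9 (R : realType) (c : weights R) :
  exists mul : Sminus1 c -> Sminus1 c -> Sminus1 c,
    (forall f g : Sminus1 c, Sval (mul f g) = gmul (Sval f) (Sval g)) /\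
    strong_algebra mul (fun p : int => @hincl R c p).
Proof. by exists (@Smul R c); split => //; exact: strong_algebra_Sminus1. Qed.
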